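(* Let $G$ be a self-similar subgroup of $\mathrm{Aut}(\mathcal T_2)$. Then $\lambda\prec\rho$ if and only if $\mathrm{Stab}_G(v\mathcal T_2)=\{1\}$ for every subtree $v\mathcal T_2$ ($v$ a vertex of $\mathcal T_2$).
   Context: $\mathcal T_2$ is the $2$-regular rooted tree: its vertex set $\mathcal T_2^0$ is the set of finite words over $X=\{1,2\}$, the root is the empty word, and each $w$ is joined to $w1,w2$. For a vertex $v$, $v\mathcal T_2$ is the subtree of vertices having $v$ as a prefix. $\mathrm{Aut}(\mathcal T_2)$ is the group of rooted tree automorphisms. For $g\in\mathrm{Aut}(\mathcal T_2)$ and a vertex $v$, $\varphi_{g(v)}(g)\in\mathrm{Aut}(\mathcal T_2)$ is defined by $g(vw)=g(v)\,\varphi_{g(v)}(g)(w)$ for all words $w$. $G$ is self-similar if $\varphi_v(g)\in G$ for all $g\in G$ and all vertices $v$. $\mathrm{Stab}_G(v\mathcal T_2)=\{g\in G\mid g(x)=x\ \forall x\in v\mathcal T_2\}$ is the pointwise stabilizer. $\rho$ is the unitary representation of $G$ on $\ell^2(\mathcal T_2^0)$ given by $(\rho(g)\xi)(x)=\xi(g^{-1}x)$, and $\lambda$ is the regular representation of the discrete group $G$ on $\ell^2(G)$. $\lambda\prec\rho$ means that $\lambda$ is weakly contained in $\rho$, i.e. $\|\lambda(x)\|\le\|\rho(x)\|$ for all $x\in\mathbb C G$. *)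

(* Defs.v *)
From HB Require Import structures.
From mathcomp Require Import all_boot all_order all_algebra.
From mathcomp Require Import finmap boolp classical_sets reals ereal esum.
From mathcomp Require Import complex.

Set Implicit Arguments.
Unset Strict Implicit.
Unset Printing Implicit Defensive.
Import Order.TTheory GRing.Theory Num.Theory.

Local Open Scope classical_set_scope.
Local Open Scope ring_scope.

(* The letters 1, 2 are represented by the two elements of 'I_2. *)
Definition vertex : Type := seq 'I_2.
HB.instance Definition _ := Choice.on vertex.

Definition child (v w : vertex) : bool := [exists x : 'I_2, w == rcons v x].

Definition adjacent (v w : vertex) : bool := child v w || child w v.

Definition rooted_automorphism (f : vertex -> vertex) : Prop :=
  [/\ bijective f, f [::] = [::]
    & forall v w, adjacent (f v) (f w) = adjacent v w].

Record tree_aut := TreeAut {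
  tree_aut_fun :> vertex -> vertex;
  tree_autP : rooted_automorphism tree_aut_fun }.

HB.instance Definition _ := gen_eqMixin tree_aut.
HB.instance Definition _ := gen_choiceMixin tree_aut.

Lemma tree_aut_eq (f g : tree_aut) : f =1 g -> f = g.
Proof.
case: f g => f fP [g gP] /= /funext fg; case: g / fg gP => gP.
by rewrite (Prop_irrelevance fP gP).
Qed.

Section GroupStructure.
Implicit Types f g h : tree_aut.

Lemma tree_aut_inj f : injective f.
Proof. by have [/bij_inj] := tree_autP f. Qed.

Lemma id_rooted_automorphism : rooted_automorphism id.
Proof. by split=> //; exists id. Qed.

Lemma comp_rooted_automorphism f g : rooted_automorphism (f \o g).
Proof.
case: f g => f [fb f0 fa] [g [gb g0 ga]]; split=> /=.
- exact: bij_comp.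
- by rewrite g0.
- by move=> v w; rewrite fa ga.
Qed.

Definition tree_inv_fun f (v : vertex) : vertex :=
  xget [::] [set u | f u = v].

Lemma tree_inv_funK f : cancel f (tree_inv_fun f).
Proof. by move=> v; apply: xget_unique => // u /tree_aut_inj. Qed.

Lemma tree_inv_funVK f : cancel (tree_inv_fun f) f.
Proof.
move=> v; have [[k _ fk] _ _] := tree_autP f.
by rewrite -(fk v) tree_inv_funK.
Qed.

Lemma inv_rooted_automorphism f : rooted_automorphism (tree_inv_fun f).
Proof.
have [_ f0 fa] := tree_autP f; split.
- exists f; [exact: tree_inv_funVK | exact: tree_inv_funK].
- by rewrite -[in LHS]f0 tree_inv_funK.
- by move=> v w; rewrite -fa !tree_inv_funVK.
Qed.

Definition tree_one : tree_aut := TreeAut id_rooted_automorphism.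
Definition tree_mul f g : tree_aut := TreeAut (comp_rooted_automorphism f g).
Definition tree_inv f : tree_aut := TreeAut (inv_rooted_automorphism f).

Lemma tree_mulA : associative tree_mul.
Proof. by move=> f g h; apply: tree_aut_eq. Qed.

Lemma tree_1mul : left_id tree_one tree_mul.
Proof. by move=> f; apply: tree_aut_eq. Qed.

Lemma tree_mul1 : right_id tree_one tree_mul.
Proof. by move=> f; apply: tree_aut_eq. Qed.

Lemma tree_Vmul : left_inverse tree_one tree_inv tree_mul.
Proof. by move=> f; apply: tree_aut_eq => v; exact: tree_inv_funK. Qed.

Lemma tree_mulV : right_inverse tree_one tree_inv tree_mul.
Proof. by move=> f; apply: tree_aut_eq => v; exact: tree_inv_funVK. Qed.

End GroupStructure.

HB.instance Definition _ :=
  isGroup.Build tree_aut tree_mulA tree_1mul tree_mul1 tree_Vmul tree_mulV.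

Section Sections.
Implicit Types (g : tree_aut) (u v w : vertex).

Lemma adjacent_rcons v x : adjacent v (rcons v x).
Proof. by apply/orP; left; apply/existsP; exists x. Qed.

Lemma tree_aut_rcons g v x : exists y, g (rcons v x) = rcons (g v) y.
Proof.
have [_ g0 ga] := tree_autP g.
elim/last_ind: v x => [|v z IH] x.
  have := ga [::] (rcons [::] x); rewrite adjacent_rcons g0.
  case/orP=> /existsP[y /eqP e]; first by exists y.
  by case: (g _) e.
have := ga (rcons v z) (rcons (rcons v z) x); rewrite adjacent_rcons.
case/orP=> /existsP[y /eqP e]; first by exists y.
have [t gt] := IH z; move: e; rewrite gt => /rcons_inj[/tree_aut_inj e _].
by have := congr1 size e; rewrite !size_rcons => /eqP; rewrite eqn_leq ltnNge leqnSn andbF.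
Qed.

Lemma size_tree_aut g v : size (g v) = size v.
Proof.
elim/last_ind: v => [|v x IH]; first by have [_ ->] := tree_autP g.
by have [y ->] := tree_aut_rcons g v x; rewrite !size_rcons IH.
Qed.

Definition section_fun g v w : vertex := drop (size (g v)) (g (v ++ w)).

Lemma section_funE g v w : g (v ++ w) = g v ++ section_fun g v w.
Proof.
rewrite -[LHS](cat_take_drop (size (g v))); congr (_ ++ _).
elim/last_ind: w => [|w x IH]; first by rewrite cats0 take_size.
rewrite -rcons_cat; have [y ->] := tree_aut_rcons g (v ++ w) x.
by rewrite -cats1 takel_cat // !size_tree_aut size_cat leq_addr.
Qed.

Lemma child_cat v w w' : child (v ++ w) (v ++ w') = child w w'.
Proof.
by apply: eq_existsb => x; rewrite rcons_cat eqseq_cat // eqxx.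
Qed.

Lemma section_funK g v :
  cancel (section_fun g v) (section_fun g^-1%g (g v)).
Proof.
move=> w; rewrite {1}/section_fun -section_funE /= !tree_inv_funK.
by rewrite drop_size_cat.
Qed.

Lemma section_rooted_automorphism g v : rooted_automorphism (section_fun g v).
Proof.
have [_ g0 ga] := tree_autP g; split.
- exists (section_fun g^-1%g (g v)); first exact: section_funK.
  by have := section_funK g^-1%g (g v); rewrite invgK /= tree_inv_funK.
- by rewrite /section_fun cats0 drop_size.
- move=> w w'; have := ga (v ++ w) (v ++ w').
  by rewrite !section_funE /adjacent !child_cat.
Qed.

(* phi u g is $\varphi_u(g)$: the index u is the image g(v) of the vertex v at
   which the section is taken, see phiE. *)
Definition phi u g : tree_aut :=
  TreeAut (section_rooted_automorphism g (g^-1%g u)).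

Lemma phiE g v w : g (v ++ w) = g v ++ phi (g v) g w.
Proof. by rewrite /= tree_inv_funK -section_funE. Qed.

End Sections.

Definition self_similar (G : groupClosed tree_aut) : Prop :=
  forall (g : tree_aut) (v : vertex), g \in G -> phi v g \in G.

Definition subtree (v : vertex) : set vertex := [set x | prefix v x].

Definition stab (G : groupClosed tree_aut) (v : vertex) : set tree_aut :=
  [set g | g \in G /\ forall x, subtree v x -> g x = x].

Section SubgroupType.
Variables (T : groupType) (G : groupClosed T).

Definition subgroup : Type := {g : T | g \in G}.

HB.instance Definition _ := SubChoice.on subgroup.

Lemma subgroup_closed : group_closed (fun g : T => g \in G).
Proof.
split=> [|g h gG hG]; first exact: gpred1.
by apply: gpredM => //; rewrite gpredV.
Qed.

HB.instance Definition _ :=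
  SubChoice_isSubGroup.Build T (fun g : T => g \in G) subgroup subgroup_closed.

End SubgroupType.

Section WeakContainment.
Variable R : realType.

(* The norm of $\ell^2(X)$, equal to +oo off $\ell^2(X)$. *)
Definition l2norm (X : choiceType) (xi : X -> R[i]) : \bar R :=
  sqrte (\esum_(x in [set: X]) (Normc.normc (xi x) ^+ 2)%:E).

Definition op_norm (X : choiceType) (T : (X -> R[i]) -> (X -> R[i])) : \bar R :=
  ereal_sup [set l2norm (T xi) | xi in [set xi | (l2norm xi <= 1)%E]].

Variable H : groupType.

Definition group_algebra : Type := {fsfun H -> R[i] with 0}.

(* The unitary representation of H on $\ell^2(X)$ induced by an action of H on
   X, and its linear extension to the group algebra; the operators are given
   on all functions, of which those in $\ell^2(X)$ form an invariant subspace. *)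
Definition perm_rep (X : choiceType) (act : H -> X -> X)
    (g : H) (xi : X -> R[i]) : X -> R[i] :=
  fun x => xi (act g^-1%g x).

Definition rep_ext (X : choiceType) (pi : H -> (X -> R[i]) -> (X -> R[i]))
    (a : group_algebra) (xi : X -> R[i]) : X -> R[i] :=
  fun x => \sum_(g <- finsupp a) a g * pi g xi x.

Definition weakly_contained (X Y : choiceType)
    (pi : H -> (X -> R[i]) -> (X -> R[i]))
    (sigma : H -> (Y -> R[i]) -> (Y -> R[i])) : Prop :=
  forall a : group_algebra,
    (op_norm (rep_ext pi a) <= op_norm (rep_ext sigma a))%E.

End WeakContainment.

Section Representations.
Variables (R : realType) (G : groupClosed tree_aut).

Definition rho : subgroup G -> (vertex -> R[i]) -> (vertex -> R[i]) :=
  perm_rep (fun (g : subgroup G) (v : vertex) => val g v).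

Definition lambda :
    subgroup G -> (subgroup G -> R[i]) -> (subgroup G -> R[i]) :=
  perm_rep (fun g h : subgroup G => (g * h)%g).

End Representations.

Arguments rho : clear implicits.
Arguments lambda : clear implicits.

(* Main.v *)
(** If every finite set of non-trivial elements of a group [H] acting on [X]
    moves a common point [x], then the orbit map [h |-> h x] is injective on
    any prescribed finite subset of [H], so finitely supported pieces of
    [lambda] embed isometrically in the representation on l^2(X). Trivial
    stabilizers of subtrees yield such common points by descending into
    smaller and smaller subtrees.

    Conversely, suppose that a non-trivial element of [G] is the identity on a
    subtree. By self-similarity some section [a <> 1] of it is the identity on
    the subtree below one vertex of level 1; a non-trivial self-similar [G]
    also swaps level 1, so a conjugate [b] of [a] is the identity on the other
    half. Then [(1 - a)(1 - b)] is a non-zero element of the group algebra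
    killed by [rho]. *)
Require Import Defs.
From mathcomp Require Import all_boot all_order all_algebra.
From mathcomp Require Import finmap boolp classical_sets reals.
From mathcomp Require Import functions cardinality ereal esum complex.

Set Implicit Arguments.
Unset Strict Implicit.
Unset Printing Implicit Defensive.
Import Order.TTheory GRing.Theory Num.Theory.

Local Open Scope classical_set_scope.
Local Open Scope ring_scope.

(** * Sums of squares and l^2 norms *)

Lemma esum_le_setT (R : realType) (X : choiceType) (P : set X)
    (u : X -> \bar R) :
  (forall x, 0 <= u x)%E ->
  (\esum_(x in P) u x <= \esum_(x in [set: X]) u x)%E.
Proof.
by move=> u0; rewrite esum_mkcond; apply: le_esum => x _; case: ifP.
Qed.

Lemma esum_setT_supp (R : realType) (X : choiceType) (P : set X)
    (u : X -> \bar R) :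
  (forall x, ~ P x -> u x = 0%E) ->
  \esum_(x in [set: X]) u x = \esum_(x in P) u x.
Proof.
move=> u0; rewrite [RHS]esum_mkcond; apply: eq_esum => x _.
by case: ifPn => // /negP xP; apply: u0 => /mem_set.
Qed.

Lemma sqr_normc_ge0 (R : realType) (z : R[i]) :
  (0 <= (Normc.normc z ^+ 2)%:E)%E.
Proof. by rewrite lee_fin sqr_ge0. Qed.

Lemma esum_sqr_normc_ge0 (R : realType) (X : choiceType) (P : set X)
    (xi : X -> R[i]) :
  (0 <= \esum_(x in P) (Normc.normc (xi x) ^+ 2)%:E)%E.
Proof. by apply: esum_ge0 => x _; exact: sqr_normc_ge0. Qed.

(** The sum defining the norm is a supremum over finite sets. This is what reduces the comparison
    with [lambda] to finitely many group elements. *)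
Lemma l2norm_le_finite (R : realType) (X : choiceType) (xi : X -> R[i])
    (M : \bar R) :
  (forall K : set X, finite_set K ->
     (sqrte (\esum_(x in K) (Normc.normc (xi x) ^+ 2)%:E) <= M)%E) ->
  (l2norm xi <= M)%E.
Proof.
move=> xiM; have M0 : (0 <= M)%E.
  by apply: le_trans (xiM set0 (finite_set0 _)); exact: sqrte_ge0.
have sqrM : M = sqrte (M ^+ 2)%E by rewrite sqrte_sqr gee0_abs.
rewrite /l2norm [X in (_ <= X)%E]sqrM lee_sqrt ?sqre_ge0//.
apply: ge_ereal_sup => _ [K [finK _] <-].
rewrite -esum_fset//; last by move=> x _; exact: sqr_normc_ge0.
by rewrite -lee_sqrt ?sqre_ge0// -sqrM; exact: xiM.
Qed.

Lemma normc_le_l2norm (R : realType) (X : choiceType) (xi : X -> R[i]) x :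
  ((Normc.normc (xi x))%:E <= l2norm xi)%E.
Proof.
have n0 : 0 <= Normc.normc (xi x).
  by case: (xi x) => a b; exact: sqrtr_ge0.
rewrite -[X in (X <= _)%E]gee0_abs ?lee_fin//.
rewrite -sqrte_sqr lee_sqrt ?esum_sqr_normc_ge0//.
rewrite -EFin_expe -(@esum_set1 _ _ x
  (fun x => (Normc.normc (xi x) ^+ 2)%:E)%E) ?sqr_normc_ge0//.
by apply: esum_le_setT => y; exact: sqr_normc_ge0.
Qed.

Lemma l2norm0 (R : realType) (X : choiceType) :
  l2norm (fun _ : X => 0 : R[i]) = 0%E.
Proof.
by rewrite /l2norm esum1 ?sqrte0// => x _; rewrite Normc.normc0 expr0n.
Qed.

Lemma l2norm_delta (R : realType) (X : choiceType) (x : X) :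
  l2norm (fun y => (y == x)%:R : R[i]) = 1%E.
Proof.
rewrite /l2norm (@esum_setT_supp _ _ [set x]); last first.
  by move=> y /eqP/negPf/= ->; rewrite Normc.normc0 expr0n.
by rewrite esum_set1 ?sqr_normc_ge0// eqxx Normc.normc1 expr1n /= sqrtr1.
Qed.

(** [eta] carries only the values of [xi] on [F], each at one point, and the rest of [xi] is lost:
    hence an inequality. *)
Lemma l2norm_pushforward (R : realType) (X Y : choiceType) (F : set X)
    (e : X -> Y) (xi : X -> R[i]) (eta : Y -> R[i]) :
  set_inj F e -> (forall x, F x -> eta (e x) = xi x) ->
  (forall y, ~ (e @` F) y -> eta y = 0) ->
  (l2norm eta <= l2norm xi)%E.
Proof.
move=> inj_e eta_e eta0; rewrite /l2norm lee_sqrt ?esum_sqr_normc_ge0//.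
rewrite (@esum_setT_supp _ _ (e @` F)); last first.
  by move=> y /eta0 ->; rewrite Normc.normc0 expr0n.
rewrite esum_image//.
under eq_esum => x Fx do rewrite eta_e//.
by apply: esum_le_setT => x; exact: sqr_normc_ge0.
Qed.

(** * Permutation representations compared with the regular one *)

Definition is_action (H : groupType) (X : Type) (act : H -> X -> X) : Prop :=
  (forall x, act 1%g x = x) /\
  (forall g h x, act (g * h)%g x = act g (act h x)).

Lemma actionK (H : groupType) (X : Type) (act : H -> X -> X) (h : H) :
  is_action act -> cancel (act h) (act h^-1%g).
Proof. by case=> act1 actM x; rewrite -actM mulVg act1. Qed.

Lemma action_fixV (H : groupType) (X : Type) (act : H -> X -> X) (h : H) x :
  is_action act -> act h x = x -> act h^-1%g x = x.
Proof. by move=> actP {1}<-; rewrite actionK. Qed.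

Lemma regular_weakly_contained (R : realType) (H : groupType)
    (X : choiceType) (act : H -> X -> X) :
  is_action act ->
  (forall s : seq H, 1%g \notin s -> exists x, {in s, forall h, act h x <> x}) ->
  weakly_contained (perm_rep (R := R) (fun g h : H => (g * h)%g))
                   (perm_rep act).
Proof.
move=> actP move_pt a; have [act1 actM] := actP.
apply: ge_ereal_sup => _ [xi xi_le1 <-].
apply: l2norm_le_finite => K /finite_fsetP[{}K ->].
(* On [K], the image of [xi] under [a] depends only on the values of [xi] on [F]. The orbit map has
   to be injective on [F] to transport [xi], and on [K] to compare the sums of squares. *)
pose F := [fset (g^-1 * k)%g | g in finsupp a, k in K]%fset.
pose E := (K `|` F)%fset.
(* If [h] and [k] send [x] to the same point, then [h^-1 * k] fixes [x]; so moving [x] by all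
   non-trivial such quotients gives injectivity on [E]. *)
have [|x x_moved] := move_pt
    [seq h <- [seq (h^-1 * k)%g | h <- E, k <- E] | h != 1%g].
  by rewrite mem_filter eqxx.
have inj_E : {in E &, injective (act^~ x)}.
  move=> h k hE kE /= hk; apply/eqP/negPn/negP => h_neq_k.
  apply: (x_moved (h^-1 * k)%g); last by rewrite actM -hk actionK.
  rewrite mem_filter -(inj_eq (mulgI h)) mulVKg mulg1 eq_sym h_neq_k.
  by apply/allpairsP; exists (h, k).
have inj_K : set_inj [set` K] (act^~ x).
  by move=> h k; rewrite !inE => hK kK; apply: inj_E; rewrite inE ?hK ?kK.
have inj_F : set_inj [set` F] (act^~ x).
  move=> h k; rewrite !inE => hF kF.
  by apply: inj_E; apply/fsetUP; right.
(* [xi] restricted to [F] and transported to the orbit of [x]; the default value 0 extends it to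
   [X]. *)
pose eta y : R[i] :=
  xget 0 [set z | exists2 h, h \in F & act h x = y /\ z = xi h].
have etaE h : h \in F -> eta (act h x) = xi h.
  move=> hF; apply: xget_unique; first by exists h.
  by move=> z [k kF [/inj_F kh ->]]; congr (xi _); apply: kh; rewrite inE.
have eta0 y : ~ ((act^~ x) @` [set` F]) y -> eta y = 0.
  by move=> yF; apply: xgetPN => z [h hF [hxy _]]; apply: yF; exists h.
have eta_le1 : (l2norm eta <= 1)%E.
  by apply: le_trans xi_le1; apply: l2norm_pushforward inj_F etaE eta0.
apply: (@le_trans _ _ (l2norm (rep_ext (perm_rep act) a eta))); last first.
  by apply: ereal_sup_ubound; exists eta.
rewrite lee_sqrt ?esum_sqr_normc_ge0//.
have -> : \esum_(k in [set` K]) (Normc.normc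
      (rep_ext (perm_rep (fun g h : H => (g * h)%g)) a xi k) ^+ 2)%:E =
    \esum_(k in [set` K])
      (Normc.normc (rep_ext (perm_rep act) a eta (act k x)) ^+ 2)%:E.
  apply: eq_esum => k /= kK; congr ((Normc.normc _ ^+ 2)%:E).
  apply: eq_big_seq => g ga; congr (_ * _).
  rewrite /perm_rep -actM etaE//.
  by apply/imfset2P; exists g => //; exists k.
rewrite -(esum_image [set` K] (act^~ x)
  (fun y => (Normc.normc (rep_ext (perm_rep act) a eta y) ^+ 2)%:E))//.
by apply: esum_le_setT => y; exact: sqr_normc_ge0.
Qed.

(** Since [c] does not vanish on [s], the support is all of [s]. *)
Lemma rep_ext_fsfun (R : realType) (H : groupType) (X : choiceType)
    (pi : H -> (X -> R[i]) -> (X -> R[i])) (s : seq H) (c : H -> R[i]) xi x :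
  uniq s -> {in s, forall g, c g != 0} ->
  rep_ext pi [fsfun g in [fset g in s]%fset => c g] xi x =
  \sum_(g <- s) c g * pi g xi x.
Proof.
move=> s_uniq c0; rewrite /rep_ext.
rewrite (perm_big s) /=; last first.
  apply: uniq_perm; [exact: fset_uniq | by []|] => g.
  rewrite mem_finsupp fsfunE !inE /=.
  by case: ifPn => [/c0 ->//|_]; rewrite eqxx.
by apply: eq_big_seq => g gs; rewrite fsfunE !inE /= gs.
Qed.

Lemma regular_not_weakly_contained (R : realType) (H : groupType)
    (X : choiceType) (act : H -> X -> X) (a b : H) :
  is_action act -> (forall h, (forall x, act h x = x) -> h = 1%g) ->
  a != 1%g -> b != 1%g -> (forall x, act a x = x \/ act b x = x) ->
  ~ weakly_contained (perm_rep (R := R) (fun g h : H => (g * h)%g))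
                     (perm_rep act).
Proof.
move=> actP faithful a1 b1 fix_ab; have [act1 actM] := actP.
have a_neq_b : a != b.
  apply: contra_neq a1 => eq_ab; apply: faithful => x.
  by case: (fix_ab x); rewrite eq_ab.
have ab1 : (a * b)%g != 1%g.
  apply: contra_neq a1 => eq_ab; apply: faithful => x.
  case: (fix_ab x) => // bx.
  by rewrite -{1}bx -actM eq_ab act1.
pose s := [:: 1%g; a; b; (a * b)%g].
pose c (g : H) : R[i] := if (g == a) || (g == b) then -1 else 1.
have s_uniq : uniq s.
  rewrite /s /= !inE !negb_or ![1%g == _]eq_sym a1 b1 ab1 a_neq_b /= andbT.
  rewrite -[X in X == _]mulg1 (inj_eq (mulgI a)) eq_sym b1 /=.
  by rewrite -[X in X == _]mul1g (inj_eq (mulIg b)) eq_sym a1.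
have c0 : {in s, forall g, c g != 0}.
  by move=> g _; rewrite /c; case: ifP; rewrite ?oppr_eq0 oner_eq0.
(* This is [(1 - a)(1 - b)], expanded; its four terms are distinct group elements. *)
pose z : group_algebra R H := [fsfun g in [fset g in s]%fset => c g].
have repzE (Y : choiceType) (act' : H -> Y -> Y) xi y :
    rep_ext (perm_rep act') z xi y =
    xi (act' 1^-1%g y) - xi (act' a^-1%g y) - xi (act' b^-1%g y)
      + xi (act' (a * b)^-1%g y).
  rewrite rep_ext_fsfun// /s !big_cons big_nil /c !eqxx orbT.
  have -> : ((a * b)%g == a) = false.
    by rewrite -[X in _ == X]mulg1 (inj_eq (mulgI a)) (negPf b1).
  have -> : ((a * b)%g == b) = false.
    by rewrite -[X in _ == X]mul1g (inj_eq (mulIg b)) (negPf a1).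
  rewrite ![1%g == _]eq_sym (negPf a1) (negPf b1) /=.
  by rewrite !mul1r !mulN1r addr0 !addrA.
move=> /(_ z); apply/negP; rewrite -ltNge.
have -> : op_norm (rep_ext (perm_rep act) z) = 0%E.
  apply/eqP; rewrite eq_le; apply/andP; split.
    apply: ge_ereal_sup => _ [xi _ <-].
    rewrite (_ : rep_ext _ _ _ = fun=> 0) ?l2norm0//; apply/funext => x.
    rewrite repzE invg1 act1 invgM actM.
    (* If [a] fixes [x], the terms of [1] and [a] cancel, and so do those of [b] and [ab]. If [b]
       fixes [x], the terms of [1] and [b] cancel; those of [a] and [ab] do so because [b] also
       fixes [a^-1 x], which is [x] itself when [a] fixes it. *)
    have [/(action_fixV actP) ax|/(action_fixV actP) bx] := fix_ab x.
      by rewrite ax subrr sub0r addNr.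
    rewrite bx; have [aax|/(action_fixV actP) ->] := fix_ab (act a^-1%g x).
      have <- : x = act a^-1%g x by rewrite -aax -actM mulgV act1.
      by rewrite bx subrr sub0r addNr.
    by rewrite addrAC subrK subrr.
  apply: ereal_sup_ubound; exists (fun=> 0); rewrite /= ?l2norm0//.
  rewrite (_ : rep_ext _ _ _ = fun=> 0) ?l2norm0//.
  by apply/funext => x; rewrite repzE !subr0 addr0.
(* The unit vector at the identity is sent to a function whose value at [1] is the coefficient of
   [1] in [z], that is 1. *)
pose delta (h : H) : R[i] := (h == 1%g)%:R.
apply: (@lt_le_trans _ _ (l2norm (rep_ext
    (perm_rep (fun g h : H => (g * h)%g)) z delta))); last first.
  by apply: ereal_sup_ubound; exists delta => //=; rewrite l2norm_delta.
apply: lt_le_trans (normc_le_l2norm _ 1%g).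
rewrite repzE /delta !mulg1 !invg_eq1 eqxx.
by rewrite (negPf a1) (negPf b1) (negPf ab1) !subr0 addr0 Normc.normc1 lte_fin.
Qed.

(** * Automorphisms of the binary tree and self-similarity *)

Lemma prefix_tree_aut (g : tree_aut) (v w : vertex) :
  g (v ++ w) = v ++ w -> g v = v.
Proof.
move=> gvw; have := section_funE g v w; rewrite gvw => /eqP.
by rewrite eqseq_cat ?size_tree_aut// => /andP[/eqP].
Qed.

Lemma letter_neq (x y z : 'I_2) : x != y -> (z == x) || (z == y).
Proof.
by case: x y z => [[|[|//]] ?] [[|[|//]] ?] [[|[|//]] ?].
Qed.

(* Below the longest prefix of [v] at which the section of [g] is not trivial,
   that section is trivial on one of the two halves of the tree. *)
Lemma stab_half (G : groupClosed tree_aut) (v : vertex) (g : tree_aut) :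
  self_similar G -> g \in G -> g <> 1%g -> (forall w, g (v ++ w) = v ++ w) ->
  exists a (x : 'I_2),
    [/\ a \in G, a <> 1%g & forall w, a (x :: w) = x :: w].
Proof.
move=> ssG; elim: v g => [|x v IH] g gG g1 gv.
  by case: g1; apply: tree_aut_eq.
have gx : g [:: x] = [:: x].
  by apply: (@prefix_tree_aut g _ v); rewrite -[v]cats0 gv.
have gxE w : g (x :: w) = x :: phi [:: x] g w.
  by have := phiE g [:: x] w; rewrite gx.
have [phi1|phi1] := pselect (phi [:: x] g = 1%g).
  by exists g, x; split=> // w; rewrite gxE phi1.
apply: IH (ssG _ [:: x] gG) phi1 _ => w.
by have := gxE (v ++ w); rewrite -cat_cons gv => -[].
Qed.

(** With two letters, an element fixing one letter fixes both. If no element swapped them, all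
    sections would fix level 1 and, by induction on words, [g] would be trivial. *)
Lemma self_similar_swap (G : groupClosed tree_aut) (g : tree_aut) :
  self_similar G -> g \in G -> g <> 1%g ->
  exists2 c : tree_aut, c \in G & forall x : 'I_2, c [:: x] <> [:: x].
Proof.
move=> ssG gG g1; apply: contrapT => noswap; apply: g1; apply: tree_aut_eq => v.
have fix1 (c : tree_aut) : c \in G -> forall x : 'I_2, c [:: x] = [:: x].
  move=> cG; have [x cx] : exists x : 'I_2, c [:: x] = [:: x].
    by apply: contrapT => /forallNP cN; apply: noswap; exists c.
  move=> y; have [->//|yx] := eqVneq y x.
  have [z cy] := tree_aut_rcons c [::] y.
  move: cy; rewrite /= (size0nil (size_tree_aut c [::])) /= => cy.
  case/orP: (letter_neq z yx) => /eqP zE; rewrite zE in cy => //.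
  (* By injectivity [c] cannot send [y] to [x], which is already the image of [x]. *)
  by move: yx; rewrite -cx in cy; move: cy => /tree_aut_inj[->]; rewrite eqxx.
elim: v g gG => [|x v IH] g gG.
  exact: size0nil (size_tree_aut g [::]).
have := phiE g [:: x] v; rewrite fix1//= => ->.
by congr cons; exact: (IH (phi [:: x] g) (ssG _ _ gG)).
Qed.

Lemma conj_half (a c : tree_aut) (x y : 'I_2) :
  (forall w, a (x :: w) = x :: w) -> c [:: x] = [:: y] ->
  forall w, (c * a * c^-1)%g (y :: w) = y :: w.
Proof.
move=> ax cx w.
have cVy : c^-1%g [:: y] = [:: x] by rewrite -cx; exact: tree_inv_funK.
have := phiE c^-1%g [:: y] w; rewrite cVy /= => cVw.
rewrite /= -/(c^-1%g) cVw ax -cVw.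
exact: tree_inv_funVK.
Qed.

(** Extending a moved word keeps it moved, because an automorphism fixing a word fixes its prefixes.
    The elements of [s] can thus be treated one by one, each inside the subtree reached so far. *)
Lemma common_moved_vertex (G : groupClosed tree_aut) (s : seq (subgroup G)) :
  (forall v, stab G v = [set 1%g]) -> 1%g \notin s ->
  exists x, {in s, forall h : subgroup G, val h x <> x}.
Proof.
move=> stab1; elim: s => [|h s IH]; first by exists [::].
rewrite inE negb_or => /andP[h1 /IH[x xs]].
have [y /prefixP[w ->] hy] : exists2 y, subtree x y & val h y <> y.
  apply: contrapT => noy; move/eqP: h1; apply; apply: val_inj.
  apply/esym; suff : stab G x (val h) by rewrite stab1.
  split; first exact: valP.
  by move=> y xy; apply: contrapT => hy; apply: noy; exists y.
exists (x ++ w) => k; rewrite inE => /orP[/eqP->//|/xs kx /prefix_tree_aut].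
exact: kx.
Qed.

Lemma vertex_action (G : groupClosed tree_aut) :
  is_action (fun (g : subgroup G) (v : vertex) => val g v).
Proof. by []. Qed.

Theorem proposition4p4 (R : realType) (G : groupClosed tree_aut)
    (self_similar_G : self_similar G) :
  weakly_contained (lambda R G) (rho R G) <->
  (forall v : vertex, stab G v = [set 1%g]).
Proof.
split=> [wc v|stab1]; last first.
  apply: regular_weakly_contained (vertex_action G) _ => s.
  exact: common_moved_vertex.
apply/seteqP; split=> [g [gG gv]|_ ->]; last by split=> //; exact: gpred1.
apply: contrapT => g1.
have gvE w : g (v ++ w) = v ++ w by apply: gv; exact: prefix_prefix.
have [a [x [aG a1 ax]]] := stab_half self_similar_G gG g1 gvE.
have [c cG swap] := self_similar_swap self_similar_G gG g1.
have [y cx] : exists y, c [:: x] = [:: y].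
  have [y] := tree_aut_rcons c [::] x.
  by rewrite (size0nil (size_tree_aut c [::])); exists y.
have xy : x != y by apply: contra_notN (swap x) => /eqP{2}->.
pose b := (c * a * c^-1)%g.
have bG : b \in G by rewrite !gpredM// gpredV.
have b1 : b <> 1%g.
  move=> /eqP; rewrite mulg_eq1 invgK -[X in _ == X]mulg1 (inj_eq (mulgI c)).
  by move/eqP.
pose a' : subgroup G := Sub a aG; pose b' : subgroup G := Sub b bG.
apply: (@regular_not_weakly_contained R _ _ _ a' b' (vertex_action G)) wc.
- by move=> h hfix; apply: val_inj; apply: tree_aut_eq.
- by apply/eqP => /(congr1 val).
- by apply/eqP => /(congr1 val).
(* Both elements fix the root; any other vertex starts with [x], where [a] acts trivially, or with
   [y], where [b] does. *)
- case=> [|z w]; first by left; exact: size0nil (size_tree_aut a [::]).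
  case/orP: (letter_neq z xy) => /eqP ->; [left; exact: ax | right].
  exact: conj_half ax cx w.
Qed.
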